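(* Let $(\mathcal{X},\Vert\cdot\Vert_{\mathcal{X}})$ and $(\mathcal{Y},\Vert\cdot\Vert_{\mathcal{Y}})$ be normed vector spaces over $\mathbb{R}$ or $\mathbb{C}$. Let $D:\mathcal{X}\to\mathcal{Y}$ be continuous and let $\rho\ge 0$. Then $D$ is $\rho$-order Lipschitz continuous if and only if $D$ is $\rho$-integrated Lipschitz continuous.
   Context: Let $(\mathcal{X},\Vert\cdot\Vert_{\mathcal{X}})$, $(\mathcal{Y},\Vert\cdot\Vert_{\mathcal{Y}})$ be normed vector spaces, $\rho\ge 0$, and $D:\mathcal{X}\to\mathcal{Y}$ continuous. $D$ is $\rho$-order Lipschitz continuous if there exist constants $C_0,C_1\ge 0$ and, for every $x\in\mathcal{X}$, there exists an open ball $B_x$ around $x$ (centered at $x$, of positive radius), such that $$\Vert D(x_1)-D(x_2)\Vert_{\mathcal{Y}}\le \left(C_0+C_1\Vert D(x)\Vert_{\mathcal{Y}}^{\rho}\right)\Vert x_1-x_2\Vert_{\mathcal{X}}\quad\text{for all }x_1,x_2\in B_x.$$ The constants $C_0,C_1$ do not depend on $x$. $D$ is $\rho$-integrated Lipschitz continuous if there exist constants $C_0,C_1\ge 0$ such that for all $x_1,x_2\in\mathcal{X}$, $$\Vert D(x_1)-D(x_2)\Vert_{\mathcal{Y}}\le \left(C_0+C_1\int_0^1\Vert D(x_1+t(x_2-x_1))\Vert_{\mathcal{Y}}^{\rho}\,dt\right)\Vert x_1-x_2\Vert_{\mathcal{X}}.$$ The constants in the two definitions need not be the same. Convention: $0^0=1$.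 *)

(* Defs.v *)
From mathcomp Require Import all_boot all_order all_algebra complex.
From mathcomp Require Import all_classical all_reals all_analysis.

Set Implicit Arguments.
Unset Strict Implicit.
Unset Printing Implicit Defensive.

Import Order.TTheory GRing.Theory Num.Theory.
Import numFieldNormedType.Exports.

Local Open Scope classical_set_scope.
Local Open Scope ring_scope.
Local Open Scope complex_scope.

Variant scalars := Reals | Complexes.

Definition scalar_field (R : realType) (k : scalars) : numFieldType :=
  match k with Reals => R | Complexes => R[i] end.

Definition of_real (R : realType) (k : scalars) : R -> scalar_field R k :=
  match k with Reals => id | Complexes => real_complex R end.

Definition real_part (R : realType) (k : scalars) : scalar_field R k -> R :=
  match k with Reals => id | Complexes => @complex.Re R end.

(* The norm of a [normedModType K] takes its values in [K]. For complex scalars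
   it is a complex number with zero imaginary part; [rnorm] is the same norm
   with values in [R]. *)
Definition rnorm (R : realType) (k : scalars)
    (V : normedModType (scalar_field R k)) (v : V) : R :=
  real_part `|v|.

(* [a `^ rho] is [powR], for which [0 `^ 0 = 1]. *)
Definition order_lipschitz (R : realType) (k l : scalars)
    (X : normedModType (scalar_field R k))
    (Y : normedModType (scalar_field R l)) (rho : R) (D : X -> Y) : Prop :=
  exists C0 C1 : R, [/\ 0 <= C0, 0 <= C1 &
    forall x : X, exists2 r : R, 0 < r &
      forall x1 x2 : X, ball x (of_real k r) x1 -> ball x (of_real k r) x2 ->
        rnorm (D x1 - D x2) <=
          (C0 + C1 * rnorm (D x) `^ rho) * rnorm (x1 - x2)].

(* The integral is real-valued ([Rintegral], equal to 0 when the integrand is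
   not integrable). For [D] continuous and [0 <= rho] the integrand is
   continuous on [0, 1], so that this default value plays no role. *)
Definition integrated_lipschitz (R : realType) (k l : scalars)
    (X : normedModType (scalar_field R k))
    (Y : normedModType (scalar_field R l)) (rho : R) (D : X -> Y) : Prop :=
  exists C0 C1 : R, [/\ 0 <= C0, 0 <= C1 &
    forall x1 x2 : X,
      rnorm (D x1 - D x2) <=
        (C0 + C1 * \int[lebesgue_measure]_(t in `[0, 1])
                     (rnorm (D (x1 + of_real k t *: (x2 - x1))) `^ rho))
        * rnorm (x1 - x2)].

(* Main.v *)
(* If [D] is order Lipschitz, then along the segment [g t = D (x1 + t (x2 - x1))]
   the local bound reads [|g b - g a| <= c t * (b - a)] for [a <= t <= b] close
   to [t], with [c] continuous. Hence, for every [e > 0],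
   [|g t - g 0| - \int_0^t c - e t] is nonincreasing across each point [t] of
   [0, 1], so that [|g 1 - g 0| <= \int_0^1 c + e].
   Conversely, on a ball around [x] where [|D| <= |D x| + 1], convexity of the
   ball bounds the integral by [(|D x| + 1)^rho <= 2^rho (|D x|^rho + 1)]. *)

Require Import Defs.
From mathcomp Require Import all_boot all_order all_algebra complex.
From mathcomp Require Import all_classical all_reals all_analysis.
From mathcomp Require Import ring lra.

Import Order.TTheory GRing.Theory Num.Theory.
Import numFieldNormedType.Exports.

Local Open Scope classical_set_scope.
Local Open Scope ring_scope.

(** * The real-valued norm over real or complex scalars *)

Section RealNorm.
Context {R : realType} {k : scalars}.
Implicit Types (V : normedModType (scalar_field R k)) (a b : R).

Lemma of_real_lt a b : (of_real k a < of_real k b) = (a < b).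
Proof. by case: k => //=; rewrite ltcR. Qed.

Lemma of_real_le a b : (of_real k a <= of_real k b) = (a <= b).
Proof. by case: k => //=; rewrite lecR. Qed.

Lemma of_realD a b : of_real k (a + b) = of_real k a + of_real k b.
Proof. by case: k => //=; rewrite rmorphD. Qed.

Lemma of_realM a b : of_real k (a * b) = of_real k a * of_real k b.
Proof. by case: k => //=; rewrite rmorphM. Qed.

Lemma of_realN a : of_real k (- a) = - of_real k a.
Proof. by case: k => //=; rewrite rmorphN. Qed.

Lemma of_real0 : of_real k 0 = 0 :> scalar_field R k.
Proof. by case: k. Qed.

Lemma of_real1 : of_real k 1 = 1 :> scalar_field R k.
Proof. by case: k. Qed.

Lemma of_real_norm a : of_real k `|a| = `|of_real k a|.
Proof. by case: k => //=; rewrite normc_def /= expr0n addr0 sqrtr_sqr. Qed.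

(** In the complex order [0 <= z] forces a zero imaginary part, so [real_part] loses nothing on
    norms; facts on norms thus transfer to [rnorm]. *)
Lemma of_real_part (z : scalar_field R k) :
  0 <= z -> of_real k (real_part z) = z.
Proof.
by case: k z => //= -[a b]; rewrite lecE /= => /andP[/eqP-> _].
Qed.

Lemma of_real_rnorm {V} (v : V) : of_real k (rnorm v) = `|v|.
Proof. by rewrite /rnorm of_real_part. Qed.

Lemma rnorm_ge0 {V} (v : V) : 0 <= rnorm v.
Proof. by rewrite -of_real_le of_real_rnorm of_real0. Qed.

Lemma rnorm0 {V} : rnorm (0 : V) = 0.
Proof. by apply/eqP; rewrite /rnorm normr0; case: k. Qed.

Lemma ler_rnormD {V} (u v : V) : rnorm (u + v) <= rnorm u + rnorm v.
Proof. by rewrite -of_real_le of_realD !of_real_rnorm ler_normD. Qed.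

Lemma rnormZ {V} a (v : V) : rnorm (of_real k a *: v) = `|a| * rnorm v.
Proof.
apply/eqP; rewrite eq_le -!of_real_le of_realM of_real_norm !of_real_rnorm.
by rewrite normrZ lexx.
Qed.

Lemma rnormN {V} (v : V) : rnorm (- v) = rnorm v.
Proof. by rewrite /rnorm normrN. Qed.

Lemma rdistC {V} (u v : V) : rnorm (u - v) = rnorm (v - u).
Proof. by rewrite -rnormN opprB. Qed.

Lemma ler_rdist_rnorm {V} (u v : V) : `|rnorm u - rnorm v| <= rnorm (u - v).
Proof.
have := ler_rnormD (u - v) v; have := ler_rnormD (v - u) u.
by rewrite !subrK rdistC ler_norml; lra.
Qed.

Lemma ball_rnormE {V} (x y : V) r :
  ball x (of_real k r) y = (rnorm (x - y) < r) :> Prop.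
Proof. by rewrite -ball_normE /= -of_real_rnorm of_real_lt. Qed.

Lemma rnorm_lineB {V} (x v : V) a b :
  rnorm ((x + of_real k a *: v) - (x + of_real k b *: v)) = `|a - b| * rnorm v.
Proof.
by rewrite opprD addrACA subrr add0r -scalerBl -of_realN -of_realD rnormZ.
Qed.

(** Balls are convex: the difference is the combination of [x - x1] and [x - x2] with weights
    [1 - t] and [t]. *)
Lemma rnorm_segment_lt {V} (x x1 x2 : V) r t :
  rnorm (x - x1) < r -> rnorm (x - x2) < r -> 0 <= t <= 1 ->
  rnorm (x - (x1 + of_real k t *: (x2 - x1))) < r.
Proof.
move=> x1r x2r /andP[t0 t1].
have -> : x - (x1 + of_real k t *: (x2 - x1)) =
    of_real k (1 - t) *: (x - x1) + of_real k t *: (x - x2).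
  have -> : x2 - x1 = (x - x1) - (x - x2).
    by rewrite opprB [RHS]addrC addrA subrK.
  rewrite opprD addrA; set u := x - x1; set w := x - x2.
  rewrite of_realD of_realN of_real1 scalerBl scale1r scalerBr opprB.
  by rewrite addrA addrAC.
apply: le_lt_trans (ler_rnormD _ _) _.
rewrite !rnormZ !ger0_norm ?subr_ge0//.
(* Bounding both norms by [m < r] first keeps the inequality strict even when a weight vanishes. *)
pose m := Num.max (rnorm (x - x1)) (rnorm (x - x2)).
have m1 : rnorm (x - x1) <= m by rewrite le_max lexx.
have m2 : rnorm (x - x2) <= m by rewrite le_max lexx orbT.
have : m < r by rewrite gt_max x1r.
by nra.
Qed.
End RealNorm.

(** * Continuity and powers of the norm *)

Lemma continuous_rnorm_lt {R : realType} {k l : scalars}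
    {X : normedModType (scalar_field R k)} {Y : normedModType (scalar_field R l)}
    {D : X -> Y} {x : X} {e : R} : {for x, continuous D} -> 0 < e ->
  exists2 d : R, 0 < d &
    forall y, rnorm (x - y) < d -> rnorm (D x - D y) < e.
Proof.
move=> cD e0; have e0' : 0 < of_real l e by rewrite -of_real0 of_real_lt.
have /cvgrPdist_lt/(_ _ e0')/nbhs_normP[d /= d0 dD] := cD.
(* The radius [d] is a scalar; being positive, it is real. *)
have dE := of_real_part _ (ltW d0).
exists (real_part d).
  by rewrite -(@of_real_lt _ k) dE of_real0.
move=> y; rewrite -(@of_real_lt _ k) dE of_real_rnorm => xy.
by rewrite -(@of_real_lt _ l) of_real_rnorm; exact: dD.
Qed.

(* The norm is there because [a `^ p = 1] for [a < 0]. *)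
Lemma powR_norm_continuous {R : realType} (p : R) :
  0 <= p -> continuous (fun a : R => `|a| `^ p).
Proof.
rewrite le_eqVlt => /predU1P[<- a|p0 a].
  under eq_fun do rewrite powRr0.
  exact: cvg_cst.
(* Away from 0 the power is differentiable at [|a|]; at 0, since [p > 0], the radius is the [p]-th
   root of [e]. *)
have [->|a0] := eqVneq a 0; last first.
  apply: (@continuous_comp R R R (fun x : R => `|x|) (@powR R ^~ p)).
    exact: norm_continuous.
  apply/differentiable_continuous/derivable1_diffP/derivable_powR.
  by rewrite in_itv/= andbT normr_gt0.
apply/cvgrPdist_lt => e e0.
have d0 : 0 < e `^ p^-1 by exact: powR_gt0.
apply/nbhs_normP; exists (e `^ p^-1) => //= x /=.
rewrite sub0r normrN => xe.
rewrite normr0 powR0 ?gt_eqF// sub0r normrN ger0_norm ?powR_ge0//.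
have -> : e = (e `^ p^-1) `^ p by rewrite -powRrM mulVf ?gt_eqF// powRr1// ltW.
by apply: gt0_ltr_powR => //; rewrite nnegrE// ltW.
Qed.

(** Either [a <= 1] and [a + 1 <= 2], or [a > 1] and [a + 1 <= 2 * a]. *)
Lemma powR_addr1 {R : realType} (p a : R) : 0 <= p -> 0 <= a ->
  (a + 1) `^ p <= 2 `^ p * (a `^ p + 1).
Proof.
move=> p0 a0; have [a1|a1] := leP a 1.
  rewrite (@le_trans _ _ (2 `^ p))//.
    by rewrite ge0_ler_powR ?nnegrE; lra.
  by rewrite ler_peMr ?powR_ge0// lerDr powR_ge0.
rewrite (@le_trans _ _ ((2 * a) `^ p))//.
  by rewrite ge0_ler_powR ?nnegrE; lra.
by rewrite powRM// ler_wpM2l ?powR_ge0// lerDl.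
Qed.

(* [h] is not assumed continuous: comparing only points on either side of [t]
   lets the supremum of [{t | h t <= h u}] be reached and then passed. *)
Lemma locally_nonincreasing_le {R : realType} (h : R -> R) (u v : R) :
  u <= v ->
  (forall t, u <= t <= v -> exists2 d : R, 0 < d &
     forall a b, u <= a -> b <= v ->
       t - d < a -> a <= t -> t <= b -> b < t + d -> h b <= h a) ->
  h v <= h u.
Proof.
move=> uv hloc.
pose A := [set t | u <= t <= v /\ h t <= h u].
have Au : A u by split; rewrite ?lexx.
have supA : has_sup A by split; [exists u | exists v => t [/andP[_ tv] _]].
set s := sup A.
have us : u <= s by exact: (ub_le_sup supA.2).
have sv : s <= v by apply: ge_sup; [exists u | move=> t [/andP[]]].
have [d d0 hd] := hloc s (introT andP (conj us sv)).
have [a [/andP[ua av] hau] sda] := sup_adherent d0 supA.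
have as' : a <= s by apply: (ub_le_sup supA.2); split=> //; apply/andP.
(* Crossing [s] from [a] to [b] puts [b] in [A]. Without truncation at [v], [b] would exceed the
   supremum [s]; hence [b = v]. *)
pose b := Num.min (s + d / 2) v.
have hb : h b <= h u.
  apply: le_trans hau; apply: hd => //; rewrite /b.
  - by rewrite ge_min lexx orbT.
  - by rewrite le_min sv andbT; lra.
  - by rewrite gt_min; apply/orP; left; lra.
have [sd|sd] := leP v (s + d / 2); first by move: hb; rewrite /b min_r.
have : b <= s.
  apply: (ub_le_sup supA.2); split => //.
  by rewrite /b le_min ge_min lexx orbT uv !andbT; lra.
by rewrite /b min_l ?(ltW sd)//; lra.
Qed.

Lemma integrable_continuous_itvcc {R : realType} (f : R -> R) (a b : R) :
  continuous f -> lebesgue_measure.-integrable `[a, b] (EFin \o f).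
Proof.
move=> cf; apply: continuous_compact_integrable; first exact: segment_compact.
exact: continuous_subspaceT.
Qed.

(** The half-open interval is what remains when an integral over [[u, a]] is subtracted from one
    over [[u, b]]. *)
Lemma ler_Rintegral_cst {R : realType} (f : R -> R) (a b c : R) :
  continuous f -> a <= b -> (forall t, a <= t <= b -> c <= f t) ->
  c * (b - a) <= \int[lebesgue_measure]_(t in `]a, b]) f t.
Proof.
move=> cf ab cle.
have I g : continuous g ->
    lebesgue_measure.-integrable `]a, b] (EFin \o (g : R -> R)).
  move=> cg; apply: integrableS (integrable_continuous_itvcc _ a b cg) => //.
  by apply: subset_itvr; rewrite bnd_simp.
have -> : c * (b - a) = \int[lebesgue_measure]_(t in `]a, b]) c.
  rewrite Rintegral_cst//= lebesgue_measure_itv/= lte_fin.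
  case: ltP ab => //= ba ab; have -> : a = b by lra.
  by rewrite subrr.
apply: le_Rintegral => //; [exact/I/cst_continuous|exact: I|].
by move=> t; rewrite /= in_itv/= => /andP[/ltW at' tb]; apply/cle/andP.
Qed.

(** A mean value inequality with local slope bounds in place of a derivative. Near [t], continuity
    keeps [c] above [c t - e'], so the integral grows as fast as [g] may, up to the slope [e']. *)
Lemma rnorm_increment_le_Rintegral {R : realType} {l : scalars}
    {Y : normedModType (scalar_field R l)} (g : R -> Y) (c : R -> R) (u v : R) :
  u <= v -> continuous c ->
  (forall t : R, exists2 d : R, 0 < d & forall a b : R, `|t - a| < d -> `|t - b| < d ->
     a <= b -> rnorm (g b - g a) <= c t * (b - a)) ->
  rnorm (g v - g u) <= \int[lebesgue_measure]_(t in `[u, v]) c t.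
Proof.
move=> uv cc gloc; apply/ler_addgt0Pr => e e0.
(* The added 1 covers [u = v], and still [e' * (v - u) <= e]. *)
pose e' := e / (v - u + 1).
have e'0 : 0 < e' by rewrite divr_gt0//; lra.
pose G t := \int[lebesgue_measure]_(s in `[u, t]) c s.
pose h t := rnorm (g t - g u) - G t - e' * t.
suff : h v <= h u.
  rewrite /h subrr rnorm0 /G set_itv1 Rintegral_set1.
  have : e' * (v - u) <= e.
    by rewrite /e' mulrAC ler_pdivrMr; nra.
  by lra.
apply: locally_nonincreasing_le => // t /andP[ut tv].
have [d d0 gd] := gloc t.
have /cvgrPdist_lt/(_ _ e'0)/nbhs_normP[d' /= d'0 cd'] := cc t.
exists (Num.min d d') => [|a b ua bv]; first by rewrite lt_min d0.
move=> tda at' tb btd.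
have [bd bd'] : b < t + d /\ b < t + d'.
  by apply/andP; rewrite -!ltrBlDl -lt_min ltrBlDl.
have [ad ad'] : t - d < a /\ t - d' < a.
  by apply/andP; rewrite !ltrBlDr -!ltrBlDl -lt_min ltrBlDl -ltrBlDr.
have ab := le_trans at' tb.
have hg : rnorm (g b - g a) <= c t * (b - a).
  by apply: gd => //; rewrite ltr_norml; lra.
have hG : (c t - e') * (b - a) <= G b - G a.
  rewrite /G Rintegral_itvB ?bnd_simp//; last first.
    exact: integrable_continuous_itvcc.
  apply: ler_Rintegral_cst => // s /andP[as' sb].
  have /cd' : `|t - s| < d' by rewrite ltr_norml; lra.
  by rewrite ltr_norml; lra.
(* Together the three bounds give [h b - h a <= (c t - (c t - e') - e') * (b - a) = 0]. *)
have hD : rnorm (g b - g u) <= rnorm (g b - g a) + rnorm (g a - g u).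
  by apply: le_trans (ler_rnormD _ _); rewrite addrA subrK.
rewrite /h; nra.
Qed.

Lemma continuous_rnorm_powR (R : realType) (k l : scalars)
    (X : normedModType (scalar_field R k)) (Y : normedModType (scalar_field R l))
    (D : X -> Y) (rho : R) (x v : X) : continuous D -> 0 <= rho ->
  continuous (fun t : R => rnorm (D (x + of_real k t *: v)) `^ rho).
Proof.
move=> cD rho0.
have -> : (fun t : R => rnorm (D (x + of_real k t *: v)) `^ rho) =
    (fun a : R => `|a| `^ rho) \o (fun t => rnorm (D (x + of_real k t *: v))).
  by apply/funext => t /=; rewrite ger0_norm ?rnorm_ge0.
move=> t; apply: continuous_comp; last exact: powR_norm_continuous.
apply/cvgrPdist_lt => e e0; apply/nbhs_normP.
have [d d0 dD] := continuous_rnorm_lt (cD (x + of_real k t *: v)) e0.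
have v0 := rnorm_ge0 v.
(* The line has speed [rnorm v]; the added 1 covers [v = 0]. *)
exists (d / (rnorm v + 1)) => [|s /=]; first by rewrite /= divr_gt0//; lra.
rewrite ltr_pdivlMr; last lra.
move=> ts; apply: le_lt_trans (ler_rdist_rnorm _ _) (dD _ _).
by rewrite rnorm_lineB (le_lt_trans _ ts)// ler_wpM2l// lerDl.
Qed.

Theorem proposition1 (R : realType) (k l : scalars)
    (X : normedModType (scalar_field R k))
    (Y : normedModType (scalar_field R l))
    (D : X -> Y) (rho : R) (hD : continuous D) (hrho : 0 <= rho) :
  order_lipschitz rho D <-> integrated_lipschitz rho D.
Proof.
split=> -[C0 [C1 [C00 C10 H]]].
- exists C0, C1; split=> // x1 x2.
  pose v := x2 - x1; pose f (t : R) := rnorm (D (x1 + of_real k t *: v)) `^ rho.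
  have cf : continuous f by exact: continuous_rnorm_powR.
  (* The order condition at the point of parameter [t] bounds the slope of [D] along the segment by
     [c t], so the constants are kept. *)
  pose c (t : R) := (C0 + C1 * f t) * rnorm v.
  have cc : continuous c.
    move=> t; apply: cvgM; last exact: cvg_cst.
    by apply: cvgD; [exact: cvg_cst|apply: cvgM; [exact: cvg_cst|exact: cf]].
  have v0 := rnorm_ge0 v.
  have := rnorm_increment_le_Rintegral
    (fun t => D (x1 + of_real k t *: v)) c 0 1 ler01 cc.
  have -> : x1 + of_real k 1 *: v = x2.
    by rewrite of_real1 scale1r addrC subrK.
  rewrite of_real0 scale0r addr0.
  rewrite rdistC (rdistC x1) -/v.
  have I := integrable_continuous_itvcc.
  have -> : \int[lebesgue_measure]_(t in `[0, 1]) c t =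
      (C0 + C1 * \int[lebesgue_measure]_(t in `[0, 1]) f t) * rnorm v.
    rewrite RintegralZr//; last first.
      by apply: I => t; apply: cvgD; [exact: cvg_cst|
        apply: cvgM; [exact: cvg_cst|exact: cf]].
    rewrite RintegralD//; [|exact/I/cst_continuous|
      by apply: I => t; apply: cvgM; [exact: cvg_cst|exact: cf]].
    rewrite RintegralZl//; last exact: I.
    rewrite Rintegral_cst//= lebesgue_measure_itv/= lte_fin ltr01 /=.
    by rewrite subr0 mulr1.
  apply => t; have [r r0 Hr] := H (x1 + of_real k t *: v).
  exists (r / (rnorm v + 1)) => [|a b ta tb ab]; first by rewrite divr_gt0//; lra.
  have bll s : `|t - s| < r / (rnorm v + 1) ->
      ball (x1 + of_real k t *: v) (of_real k r) (x1 + of_real k s *: v).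
    rewrite ball_rnormE ltr_pdivlMr; last lra.
    by move=> ts; rewrite rnorm_lineB (le_lt_trans _ ts)// ler_wpM2l// lerDl.
  apply: le_trans (Hr _ _ (bll _ tb) (bll _ ta)) _.
  by rewrite rnorm_lineB ger0_norm ?subr_ge0// /c -mulrA (mulrC (b - a)).
(* Expanding [C1 * (2^rho * (|D x|^rho + 1))] sends the summand 1 into the first constant. Only the
   radius, chosen next for the tolerance 1, depends on [x]. *)
- exists (C0 + C1 * 2 `^ rho), (C1 * 2 `^ rho).
  have p2 := powR_ge0 (2 : R) rho.
  split; [by rewrite addr_ge0// mulr_ge0|by rewrite mulr_ge0|move=> x].
  have [r r0 Hr] := continuous_rnorm_lt (hD x) ltr01.
  exists r => // x1 x2; rewrite !ball_rnormE => xx1 xx2.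
  apply: le_trans (H x1 x2) _; rewrite ler_wpM2r ?rnorm_ge0//.
  set a := rnorm (D x).
  have -> : C0 + C1 * 2 `^ rho + C1 * 2 `^ rho * a `^ rho =
      C0 + C1 * (2 `^ rho * (a `^ rho + 1)) by ring.
  rewrite lerD2l ler_wpM2l//.
  apply: le_trans (powR_addr1 _ _ _ (rnorm_ge0 (D x))) => //.
  set M := (_ + 1) `^ rho.
  (* The interval has length 1, so the constant bound becomes an integral and the integrands can be
     compared. *)
  have -> : M = \int[lebesgue_measure]_(t in `[(0:R), 1]) M.
    rewrite Rintegral_cst//= lebesgue_measure_itv/= lte_fin ltr01 /=.
    by rewrite subr0 mulr1.
  apply: le_Rintegral => //.
  - exact/integrable_continuous_itvcc/continuous_rnorm_powR.
  - exact/integrable_continuous_itvcc/cst_continuous.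
  move=> t; rewrite /= in_itv /= => /andP[t0 t1].
  rewrite ge0_ler_powR ?nnegrE ?addr_ge0 ?rnorm_ge0//.
  have xt : rnorm (x - (x1 + of_real k t *: (x2 - x1))) < r.
    by apply: rnorm_segment_lt => //; rewrite t0.
  have := ler_rdist_rnorm (D x) (D (x1 + of_real k t *: (x2 - x1))).
  have := Hr _ xt.
  by rewrite ler_norml; lra.
Qed.
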